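(* Let $T$ be a finite metric tree and let $X\subseteq T$. If $d_{\mathrm{H}}(T,X)>\vec d_{\mathrm{H}}(\partial T,X)$, then $d_{\mathrm{GH}}(T,X)=d_{\mathrm{H}}(T,X)$.
   Context: A finite metric graph is a connected metric space obtained by gluing a finite collection of segments $[0,l]$ (the edges, $l$ being the length of the edge) along their endpoints to a finite set of vertices, equipped with the quotient (shortest-path) metric. A finite metric tree is a finite metric graph containing no simple loop (no subset homeomorphic to a circle). $\partial T$ is the set of leaves, i.e. vertices of degree one. For subsets $A,B$ of a metric space $(Z,d)$, $\vec d_{\mathrm{H}}(A,B)=\sup_{a\in A}\inf_{b\in B}d(a,b)$ is the directed Hausdorff distance. $d_{\mathrm{H}}$ is the (symmetric) Hausdorff distance between subsets of $T$ and $d_{\mathrm{GH}}$ is the Gromov--Hausdorff distance, where $X$ carries the metric restricted from $T$. *)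

(* Defs.v *)
From HB Require Import structures.
From mathcomp Require Import all_boot all_order all_algebra.
From mathcomp Require Import all_classical all_reals all_analysis.

Set Implicit Arguments.
Unset Strict Implicit.
Unset Printing Implicit Defensive.
Import Order.TTheory GRing.Theory Num.Theory.
Import numFieldNormedType.Exports.
Local Open Scope classical_set_scope.
Local Open Scope ring_scope.

(** Hausdorff distances are valued in [\bar R], with the usual conventions
    [ereal_sup set0 = -oo] and [ereal_inf set0 = +oo]. *)
Definition dir_hausdorff (R : realType) (Z : metricType R) (A B : set Z) : \bar R :=
  ereal_sup [set ereal_inf [set (mdist a b)%:E | b in B] | a in A].

Definition hausdorff_dist (R : realType) (Z : metricType R) (A B : set Z) : \bar R :=
  maxe (dir_hausdorff A B) (dir_hausdorff B A).

Definition isometric_embedding (R : realType) (S Z : metricType R) (f : S -> Z) : Prop :=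
  forall x y : S, mdist (f x) (f y) = mdist x y.

Definition gromov_hausdorff (R : realType) (S T : metricType R) : \bar R :=
  ereal_inf [set r | exists (Z : metricType R) (f : S -> Z) (g : T -> Z),
    [/\ isometric_embedding f, isometric_embedding g
      & r = hausdorff_dist (range f) (range g)]].

(** The subset [X] of [T] as a metric space, with the metric of [T] restricted;
    an alias of [set_type X], so that [set_type] gets no global instance. *)
Definition restricted (R : realType) (T : metricType R) (X : set T) : Type :=
  set_type X.

Section restricted_metric.
Context (R : realType) (T : metricType R) (X : set T).

HB.instance Definition _ := gen_eqMixin (restricted X).
HB.instance Definition _ := gen_choiceMixin (restricted X).

Let rdist (x y : restricted X) : R := mdist (\val x) (\val y).

Let rdistxx x : rdist x x = 0.
Proof. exact: mdistxx. Qed.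

Let rdist_positivity x y : rdist x y = 0 -> x = y.
Proof. by move=> /mdist_positivity /val_inj. Qed.

Let rdist_sym x y : rdist x y = rdist y x.
Proof. exact: metric_sym. Qed.

Let rdist_triangle y x z : rdist x z <= rdist x y + rdist y z.
Proof. exact: metric_triangle. Qed.

HB.instance Definition _ := isMetric.Build R (restricted X)
  rdistxx rdist_positivity rdist_sym rdist_triangle.

End restricted_metric.

Lemma mdist_restricted (R : realType) (T : metricType R) (X : set T)
  (x y : restricted X) : mdist x y = mdist (\val x : T) (\val y).
Proof. by []. Qed.

(** Gluing data: the end [0] of the segment of [e] is attached to
    [endpoint e false] and its end [elen e] to [endpoint e true].  Loops and
    multiple edges are allowed. *)
Record gluing (R : realType) := Gluing {
  vertex : finType ;
  edge : finType ;
  endpoint : edge -> bool -> vertex ;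
  elen : edge -> R ;
  elen_gt0 : forall e, 0 < elen e }.

Section gluing_theory.
Context (R : realType) (G : gluing R).

(** Number of edge ends at [v]: a loop counts twice. *)
Definition degree (v : vertex G) : nat :=
  #|[set h : edge G * bool | endpoint h.1 h.2 == v]|.

(** The disjoint union of the vertices and of the segments [[0, elen e]] is
    the set of the [p : prepoint] such that [in_pieces p]. *)
Definition prepoint : Type := (vertex G + edge G * R)%type.

Definition in_pieces (p : prepoint) : Prop :=
  match p with
  | inl _ => True
  | inr (e, t) => 0 <= t <= elen e
  end.

Definition segment_end (e : edge G) (b : bool) : prepoint :=
  inr (e, if b then elen e else 0).

(** [chain p q c]: one can go from [p] to [q] by finitely many moves inside a
    segment, of total length [c], and jumps between identified points. *)
Inductive chain : prepoint -> prepoint -> R -> Prop :=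
| chain_refl p : chain p p 0
| chain_move e s t q c : 0 <= s <= elen e -> 0 <= t <= elen e ->
    chain (inr (e, t)) q c -> chain (inr (e, s)) q (`|s - t| + c)
| chain_to_vertex e b q c :
    chain (inl (endpoint e b)) q c -> chain (segment_end e b) q c
| chain_from_vertex e b q c :
    chain (segment_end e b) q c -> chain (inl (endpoint e b)) q c.

(** The quotient semi-metric; it is [+oo] when no chain joins [p] to [q]. *)
Definition glued_dist (p q : prepoint) : \bar R :=
  ereal_inf [set c%:E | c in [set c | chain p q c]].

End gluing_theory.

(** A metric space with a gluing of which it is the metric quotient.  No
    separate condition on the fibres of [fmg_proj] is needed: two points have
    the same image iff their glued distance is 0, that is (edge lengths being
    positive) iff they are identified by the gluing. *)
Record finite_metric_graph (R : realType) := FiniteMetricGraph {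
  fmg_space :> metricType R ;
  fmg_gluing : gluing R ;
  fmg_proj : prepoint fmg_gluing -> fmg_space ;
  fmg_proj_surj : forall x : fmg_space,
    exists2 p, in_pieces p & fmg_proj p = x ;
  fmg_proj_dist : forall p q, in_pieces p -> in_pieces q ->
    (mdist (fmg_proj p) (fmg_proj q))%:E = glued_dist p q ;
  fmg_connected : connected [set: fmg_space] }.

Definition homeomorphic (S T : topologicalType) (A : set S) (B : set T) : Prop :=
  exists (f : S -> T) (g : T -> S),
    [/\ set_fun A B f, set_fun B A g,
        {within A, continuous f}, {within B, continuous g}
      & (forall x, A x -> g (f x) = x) /\ (forall y, B y -> f (g y) = y)].

Definition unit_circle (R : realType) : set (R * R) :=
  [set p | p.1 ^+ 2 + p.2 ^+ 2 = 1].

Definition is_metric_tree (R : realType) (T : finite_metric_graph R) : Prop :=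
  ~ exists A : set T, homeomorphic A (@unit_circle R).

Definition leaves (R : realType) (T : finite_metric_graph R) : set T :=
  [set fmg_proj (inl v) | v in [set v : vertex (fmg_gluing T) | degree v = 1%N]].
Arguments leaves {R} T.

(* Main.v *)
Require Import Defs.
From mathcomp Require Import all_boot all_order all_algebra.
From mathcomp Require Import all_classical all_reals all_analysis.
From mathcomp Require Import lra.

Set Implicit Arguments.
Unset Strict Implicit.
Unset Printing Implicit Defensive.
Import Order.TTheory GRing.Theory Num.Theory.
Import numFieldNormedType.Exports.
Local Open Scope classical_set_scope.
Local Open Scope ring_scope.

(** Suppose that [T] and [X] are embedded isometrically in [Z] at Hausdorff
    distance less than [r], where [vec d_H(leaves, X) < r < d_H(T, X)].  Some
    point of [T] is at distance more than [r] from [X], and it can be moved to a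
    point [p] in the interior of an edge.  In a tree this edge is a bridge, so
    [p] cuts [T] into two sides, any two points of which on different sides
    satisfy [d(a, b) = d(a, p) + d(p, b)], and each of which contains a leaf.
    Since the leaves are [r]-close to [X], each side contains points of [X], and
    points of [X] on different sides are more than [2 r] apart.  Hence the open
    [r]-neighbourhoods in [Z] of the two parts of [X] are disjoint and both meet
    [T], which they cover: this contradicts the connectedness of [T].

    If an edge were not a bridge, it would lie on a simple cycle of the gluing;
    this cycle and the circle are quotients of the same compact space (a
    disjoint union of segments) by the same relation, hence homeomorphic. *)

(** * The circle as a quotient of segments *)

Section quotients_of_a_compact.
Context (I : finType) (i0 : I) (U : topologicalType) (K : set U) (u0 : U).

(** The preimage of a closed [C] is a finite union of images [phi i] of the compact sets [K]
    intersected with [psi i @^-1] [C], so it is closed because [S] is Hausdorff. Off that union,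
    [psi i0 u0] serves as a default value. *)
Lemma fiberwise_continuous_map (S T : topologicalType) (phi : I -> U -> S)
    (psi : I -> U -> T) :
  compact K -> hausdorff_space S ->
  (forall i, continuous (phi i)) -> (forall i, continuous (psi i)) ->
  (forall i j u v, K u -> K v -> phi i u = phi j v -> psi i u = psi j v) ->
  exists2 f : S -> T, {within \bigcup_i (phi i @` K), continuous f} &
    forall i u, K u -> f (phi i u) = psi i u.
Proof.
move=> cK hS cphi cpsi fib.
have [f fE] : exists f : S -> T, forall i u, K u -> f (phi i u) = psi i u.
  suff /choice[f fE] : forall x : S, exists y : T,
      forall i u, K u -> phi i u = x -> y = psi i u.
    by exists f => i u Ku; exact: fE.
  move=> x; have [[i [u [Ku <-]]]|nx] :=
      pselect (exists i u, K u /\ phi i u = x).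
    by exists (psi i u) => j v Kv /esym; exact: fib.
  by exists (psi i0 u0) => i u Ku iux; case: nx; exists i, u.
exists f => //; apply/continuous_closedP => C clC; apply/closed_subspaceP.
exists (\bigcup_i (phi i @` (K `&` psi i @^-1` C))).
  apply: closed_bigcup => [|i _]; first exact: finite_finset.
  apply: compact_closed => //; apply: continuous_compact.
    exact: continuous_subspaceT.
  by apply: compact_closedI => //; move/continuous_closedP: (cpsi i); apply.
apply/seteqP; split => [x [[i _ [u [Ku Cu] <-]] xA]|x [Cx [i _ [u Ku ux]]]].
  by split; [rewrite /preimage/from_subspace/= fE|exact: xA].
split; last by exists i => //; exists u.
by exists i => //; exists u => //; split => //=; rewrite -fE// ux.
Qed.

Lemma quotients_homeomorphic (S T : topologicalType) (phi : I -> U -> S)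
    (psi : I -> U -> T) :
  compact K -> hausdorff_space S -> hausdorff_space T ->
  (forall i, continuous (phi i)) -> (forall i, continuous (psi i)) ->
  (forall i j u v, K u -> K v -> phi i u = phi j v <-> psi i u = psi j v) ->
  homeomorphic (\bigcup_i (phi i @` K)) (\bigcup_i (psi i @` K)).
Proof.
move=> cK hS hT cphi cpsi fib.
have [|f cf fE] := fiberwise_continuous_map cK hS cphi cpsi.
  by move=> i j u v Ku Kv /fib; apply.
have [|g cg gE] := fiberwise_continuous_map cK hT cpsi cphi.
  by move=> i j u v Ku Kv /fib; apply.
exists f, g; split=> //.
- by move=> _ [i _ [u Ku <-]]; exists i => //; exists u => //; rewrite fE.
- by move=> _ [i _ [u Ku <-]]; exists i => //; exists u => //; rewrite gE.
- by split=> _ [i _ [u Ku <-]]; rewrite ?fE ?gE ?fE.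
Qed.

End quotients_of_a_compact.

Section circle.
Context (R : realType).

Definition circle_point (x : R) : R * R := (cos (pi *+ 2 * x), sin (pi *+ 2 * x)).

Lemma continuous_circle_point : continuous circle_point.
Proof.
have cont (f : R -> R) : continuous f -> continuous (fun x => f (pi *+ 2 * x)).
  move=> cf x; apply: (@continuous_comp _ _ _ ( *%R (pi *+ 2)) f).
    exact: mulrl_continuous.
  exact: cf.
move=> x; apply: (@cvg_pair _ _ _ (nbhs x) (nbhs _) (nbhs _)).
  exact: cont (@continuous_cos R) _.
exact: cont (@continuous_sin R) _.
Qed.

Lemma sin_eq0_pi (x : R) : - pi <= x <= pi -> sin x = 0 ->
  [\/ x = 0, x = pi | x = - pi].
Proof.
move=> /andP[xl xr] s0; have [x0|x0|->] := ltgtP x 0; last by constructor 1.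
  constructor 3; apply/eqP; rewrite eq_le xl andbT leNgt; apply/negP => lx.
  suff /sin_gt0_pi : 0 < - x < pi by rewrite sinN s0 oppr0 ltxx.
  by apply/andP; split; lra.
constructor 2; apply/eqP; rewrite eq_le xr leNgt; apply/negP => lx.
suff /sin_gt0_pi : 0 < x < pi by rewrite s0 ltxx.
by apply/andP; split; lra.
Qed.

Lemma circle_point_eq (x y : R) : 0 <= x <= 1 -> 0 <= y <= 1 ->
  circle_point x = circle_point y <-> [\/ x = y, x = y + 1 | y = x + 1].
Proof.
move=> /andP[x0 x1] /andP[y0 y1]; have pi0 : 0 < pi :> R := pi_gt0 R; split.
  move=> [cxy sxy].
  (* The full angle has cosine 1, so the half angle has sine 0; the half angle lies in [-pi, pi],
     where the zeros of sine are known. *)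
  have c1 : cos (pi *+ 2 * (x - y)) = 1.
    by rewrite mulrBr cosB cxy sxy -!expr2 cos2Dsin2.
  have s0 : sin (pi * (x - y)) = 0.
    apply/eqP; rewrite -sqrf_eq0 sin2cos2; move: c1.
    by rewrite mulrnAl cos_mulr2n => c1; apply/eqP; lra.
  have : - pi <= pi * (x - y) <= pi by apply/andP; split; nra.
  move=> /sin_eq0_pi /(_ s0)[] E.
  - by constructor 1; move/eqP: E; rewrite mulf_eq0 gt_eqF//= subr_eq0 => /eqP.
  - by constructor 2; apply: (mulfI (lt0r_neq0 pi0)); lra.
  - by constructor 3; apply: (mulfI (lt0r_neq0 pi0)); lra.
have per z : circle_point (z + 1) = circle_point z.
  by rewrite /circle_point mulrDr mulr1 cosD2pi sinD2pi.
by case=> ->.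
Qed.

Lemma circle_point_range : circle_point @` `[0, 1] = @unit_circle R.
Proof.
have pi0 : 0 < pi :> R := pi_gt0 R.
have pi2_gt0 : 0 < pi *+ 2 :> R by rewrite mulr2n addr_gt0.
have pi2_neq0 : pi *+ 2 != 0 :> R by rewrite gt_eqF.
apply/seteqP; split=> [_ [x _ <-]|]; first exact: cos2Dsin2.
move=> [x y]; rewrite /unit_circle/= => xy1.
have x1 : -1 <= x <= 1 by apply/andP; split; nra.
have sx : sin (acos x) = `|y|.
  by rewrite sin_acos// (_ : 1 - _ = y ^+ 2) ?sqrtr_sqr//; lra.
have [a0 api] : 0 <= acos x /\ acos x <= pi by rewrite acos_ge0 ?acos_lepi.
(* [acos] parametrises the upper half circle; the lower half is its reflection, which replaces the
   parameter by 1 minus it. *)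
have [y0|y0] := leP 0 y.
  exists (acos x / (pi *+ 2)).
    rewrite /= in_itv/= divr_ge0 ?ler_pdivrMr ?mul1r//; [lra|exact: ltW].
  by rewrite /circle_point mulrCA divff// mulr1 acosK// sx ger0_norm.
exists (1 - acos x / (pi *+ 2)).
  rewrite /= in_itv/= subr_ge0 ler_pdivrMr// mul1r gerBl divr_ge0 ?(ltW pi2_gt0)// andbT.
  by rewrite (le_trans api)// mulr2n lerDl ltW.
rewrite /circle_point mulrBr mulr1 mulrCA divff// mulr1.
rewrite cosB sinB cos2pi sin2pi !mul1r !mul0r addr0 sub0r acosK// sx.
by rewrite ltr0_norm// opprK.
Qed.

End circle.

(** * Metric graphs *)

Section potentials.
Context (R : realType) (G : gluing R).
Implicit Types (p q : prepoint G) (h : prepoint G -> R).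

(* The functions that descend to 1-Lipschitz functions on the quotient: they
   bound glued distances from below. *)
Definition potential h : Prop :=
  (forall e s t, 0 <= s <= elen e -> 0 <= t <= elen e ->
     h (inr (e, s)) - h (inr (e, t)) <= `|s - t|) /\
  (forall e b, h (segment_end e b) = h (inl (endpoint e b))).

Lemma chain_potential h p q c : potential h -> chain p q c -> h p - h q <= c.
Proof.
move=> [hlip hjump]; elim=> {p q c} [p|e s t q c s01 t01 _ IH|e b q c _ IH|e b q c _ IH].
- by rewrite subrr.
- by rewrite -(subrKA (h (inr (e, t)))) lerD// hlip.
- by rewrite hjump.
- by rewrite -hjump.
Qed.

Lemma segment_end_in e b : in_pieces (segment_end (G := G) e b).
Proof. by case: b => /=; rewrite lexx ltW// elen_gt0. Qed.

(** A tent on [e0] with peak at [s0]. Its height [w] is at most the distance from [s0] to either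
    end, so it vanishes at both ends and extends by 0. *)
Lemma potential_tent e0 s0 : 0 < s0 < elen e0 ->
  exists2 h, potential h &
    forall q, in_pieces q -> h (inr (e0, s0)) <= h q -> q = inr (e0, s0).
Proof.
move=> /andP[s0_gt0 s0_lt]; pose w := Num.min s0 (elen e0 - s0).
have [ws0 ws1] : w <= s0 /\ w <= elen e0 - s0 by rewrite /w !ge_min !lexx orbT.
have w0 : 0 < w by rewrite /w lt_min s0_gt0 subr_gt0.
pose h p := if p is inr (e, s) then
  if e == e0 then Num.max 0 (w - `|s - s0|) else 0 else 0.
exists h.
  split=> [e s t _ _|e b] /=.
    case: ifP => _; last by rewrite subrr.
    have := ler_distD s t s0; rewrite (distrC t s).
    by rewrite !maxEle; case: ifP => [|/negbT]; case: ifP => [|/negbT];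
      rewrite -?ltNge; have := normr_ge0 (s - t); lra.
  case: eqP => // ee0; apply/max_idPl; subst e; rewrite subr_le0.
  case: b; first by rewrite ger0_norm ?subr_ge0// ltW.
  by rewrite sub0r normrN gtr0_norm.
move=> [v|[e s]] /= _; rewrite eqxx subrr normr0 subr0 (max_idPr (ltW w0)).
  by rewrite leNgt w0.
case: eqP => [->|_]; last by rewrite leNgt w0.
rewrite le_max leNgt w0/= lerBrDl gerDr normr_le0 subr_eq0.
by move=> /eqP ->.
Qed.

(** The value [m] at [v0] and 0 at the other vertices is interpolated linearly along the edges;
    slopes are at most 1 because [m] is at most every edge length. *)
Lemma potential_vertex v0 :
  exists2 h, potential h &
    forall v, h (inl v0) <= h (inl v) -> v = v0.
Proof.
have [m m0 mle] : exists2 m : R, 0 < m & forall e : edge G, m <= elen e.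
  (* The default 1 keeps [m] positive when there are no edges. *)
  exists (\big[Num.min/1]_(e : edge G) elen e); last by move=> e; exact: bigmin_le_cond.
  by apply: lt_bigmin => // e _; exact: elen_gt0.
pose w v := if v == v0 then m else 0.
have w0m v : 0 <= w v <= m by rewrite /w; case: ifP; rewrite !lexx ltW.
pose h (p : prepoint G) := match p with
  | inl v => w v
  | inr (e, s) => w (endpoint e false)
      + (w (endpoint e true) - w (endpoint e false)) * (s / elen e) end.
exists h; last first.
  by move=> v /=; rewrite /w eqxx; case: eqP => // _; rewrite leNgt m0.
split=> [e s t _ _|e [] /=].
- rewrite /= opprD addrACA subrr add0r -mulrBr -mulrBl mulrA (le_trans (ler_norm _))//.
  rewrite normrM normrM normfV (gtr0_norm (elen_gt0 e)) ler_pdivrMr ?elen_gt0//.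
  rewrite mulrC ler_wpM2l//.
  move: (w0m (endpoint e true)) (w0m (endpoint e false)) (mle e).
  by move=> /andP[? ?] /andP[? ?] ?; rewrite ler_norml; apply/andP; split; lra.
- by rewrite divff ?gt_eqF ?elen_gt0// mulr1 addrC subrK.
- by rewrite mul0r mulr0 addr0.
Qed.

End potentials.

Section finite_metric_graph.
Context (R : realType) (T : finite_metric_graph R).
Local Notation G := (fmg_gluing T).
Implicit Types (p q : prepoint G).

(** Equal images are at glued distance 0, and every chain is at least as long as the drop of a
    potential. Potentials thus recover from the metric which points are identified. *)
Lemma fmg_proj_le p q h : in_pieces p -> in_pieces q -> potential h ->
  fmg_proj p = fmg_proj q :> T -> h p <= h q.
Proof.
move=> ip iq hpot pq; have := fmg_proj_dist ip iq; rewrite pq mdistxx => d0.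
rewrite -subr_le0 -lee_fin d0; apply: le_ereal_inf_tmp => _ [c pqc <-].
by rewrite lee_fin (chain_potential hpot pqc).
Qed.

Lemma fmg_proj_interior e s q : 0 < s < elen e -> in_pieces q ->
  fmg_proj (inr (e, s)) = fmg_proj q :> T -> q = inr (e, s).
Proof.
move=> se iq sq; have [h hpot hq] := potential_tent se.
apply: hq => //; apply: fmg_proj_le => //=.
by case/andP: se => /ltW -> /ltW ->.
Qed.

Lemma fmg_proj_vertex_inj :
  injective (fun v : vertex G => fmg_proj (inl v) : T).
Proof.
move=> u v uv; have [h hpot hq] := potential_vertex u.
by apply/esym/hq; exact: fmg_proj_le.
Qed.

Lemma mdist_fmg_proj_le p q c : in_pieces p -> in_pieces q -> chain p q c ->
  mdist (fmg_proj p : T) (fmg_proj q) <= c.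
Proof.
move=> ip iq pqc; rewrite -lee_fin fmg_proj_dist//.
by apply: ereal_inf_lbound; exists c.
Qed.

Lemma fmg_proj_end e b :
  fmg_proj (segment_end e b) = fmg_proj (inl (endpoint e b)) :> T.
Proof.
apply: mdist_positivity; apply/eqP; rewrite eq_le mdist_ge0 andbT.
apply: mdist_fmg_proj_le => //; first exact: segment_end_in.
by apply: chain_to_vertex; exact: chain_refl.
Qed.

Lemma mdist_fmg_proj_segment e s t : 0 <= s <= elen e -> 0 <= t <= elen e ->
  mdist (fmg_proj (inr (e, s)) : T) (fmg_proj (inr (e, t))) <= `|s - t|.
Proof.
move=> si ti; apply: mdist_fmg_proj_le => //; rewrite -[`|_|]addr0.
by apply: chain_move => //; exact: chain_refl.
Qed.

Lemma continuous_fmg_proj_segment e (f : R -> R) : continuous f ->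
  (forall s, 0 <= f s <= elen e) ->
  continuous (fun s => fmg_proj (inr (e, f s)) : T).
Proof.
move=> cf fe s; apply/cvg_ballP => r r0; near=> t.
rewrite ballEmdist /=; apply: le_lt_trans (mdist_fmg_proj_segment _ _) _ => //.
by near: t; move/cvg_ballP : (cf s) => /(_ _ r0).
Unshelve. all: by end_near. Qed.

End finite_metric_graph.

(** * Simple cycles of the gluing are circles *)

Section cycles.
Context (R : realType) (T : finite_metric_graph R).
Local Notation G := (fmg_gluing T).
Context (n : nat) (x : 'I_n.+1 -> vertex G) (d : 'I_n.+1 -> edge G)
  (b : 'I_n.+1 -> bool).
Hypotheses (x_inj : injective x) (d_inj : injective d).
Hypothesis d_tail : forall i, endpoint (d i) (b i) = x i.
Hypothesis d_head : forall i, endpoint (d i) (~~ b i) = x (ordS i).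

(** A retraction onto [0, 1], so that the parametrisations below are continuous on all of [R]. *)
Let clamp (s : R) : R := Num.max 0 (Num.min 1 s).

Let clamp01 s : 0 <= clamp s <= 1.
Proof. by rewrite /clamp le_max lexx ge_max ler01 ge_min lexx. Qed.

Let clampE (s : R) : 0 <= s <= 1 -> clamp s = s.
Proof. by move=> /andP[s0 s1]; rewrite /clamp (min_idPr s1) (max_idPr s0). Qed.

(** The edge [d i] is run from its end [b i], hence backwards when [b i] is true: [s = 0] gives
    [x i] and [s = 1] gives [x (ordS i)]. *)
Let position i (s : R) : R :=
  (if b i then 1 - clamp s else clamp s) * elen (d i).

Let cycle_map i s : T := fmg_proj (inr (d i, position i s)).

Let position_in i s : 0 <= position i s <= elen (d i).
Proof.
have /andP[c0 c1] := clamp01 s; have l0 := elen_gt0 (d i); rewrite /position.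
by case: (b i); apply/andP; split; nra.
Qed.

Let continuous_cycle_map i : continuous (cycle_map i).
Proof.
have cclamp : continuous clamp.
  move=> s; apply: (@continuous_max _ _ (fun=> 0)); first exact: cvg_cst.
  by apply: (@continuous_min _ _ (fun=> 1)); first exact: cvg_cst.
apply: continuous_fmg_proj_segment => // s; rewrite /position.
apply: continuousM; last exact: cvg_cst.
case: (b i); last exact: cclamp.
by apply: continuousB; [exact: cvg_cst|exact: cclamp].
Qed.

Let cycle_time i (s : R) : R := i%:R + s.

(** Equality modulo [n.+1]: for parameters in [0, 1] the times lie in [0, [n.+1]], so no other
    multiple can occur. *)
Let same_time i j s t : Prop :=
  [\/ cycle_time i s = cycle_time j t,
      cycle_time i s = cycle_time j t + n.+1%:R |
      cycle_time j t = cycle_time i s + n.+1%:R].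

Let same_timeC i j s t : same_time i j s t <-> same_time j i t s.
Proof.
by split=> -[E|E|E]; [constructor 1|constructor 3|constructor 2
                     |constructor 1|constructor 3|constructor 2].
Qed.

(** The last alternative is the end of the last edge, which is reached at time [n.+1] and closes up
    at the vertex of index 0. *)
Let cycle_map_end i s : s = 0 \/ s = 1 ->
  exists2 k : 'I_n.+1, cycle_map i s = fmg_proj (inl (x k)) &
    cycle_time i s = k%:R \/ (cycle_time i s = n.+1%:R /\ k%:R = 0 :> R).
Proof.
move=> [->|->].
  exists i; last by left; rewrite /cycle_time addr0.
  rewrite -d_tail -fmg_proj_end /cycle_map /position /segment_end.
  by rewrite clampE ?lexx ?ler01//; case: (b i); rewrite ?subr0 ?mul1r ?mul0r.
exists (ordS i).
  rewrite -d_head -fmg_proj_end /cycle_map /position /segment_end.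
  by rewrite clampE ?lexx ?ler01//; case: (b i); rewrite ?subrr ?mul1r ?mul0r.
rewrite /cycle_time natr1 /=; have [ni|ni] := eqVneq (i : nat) n.
  by right; rewrite ni modnn.
by left; rewrite modn_small// ltnS ltn_neqAle ni -ltnS ltn_ord.
Qed.

Let cycle_map_interior i j (s t : R) : 0 < s < 1 -> 0 <= t <= 1 ->
  cycle_map i s = cycle_map j t <-> same_time i j s t.
Proof.
move=> s01 t01; have [s0 s1] := andP s01; have [t0 t1] := andP t01.
have s01' : 0 <= s <= 1 by rewrite !ltW.
have Ei : i.+1%:R <= n.+1%:R :> R by rewrite ler_nat ltn_ord.
have Ej : j.+1%:R <= n.+1%:R :> R by rewrite ler_nat ltn_ord.
have i0 : 0 <= i%:R :> R by []. have j0 : 0 <= j%:R :> R by [].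
rewrite -natr1 in Ei; rewrite -natr1 in Ej.
split=> [|]; last first.
  (* Since [0 < s < 1], the time of [s] is strictly between 0 and [n.+1], which excludes both
     wrap-around cases. *)
  rewrite /same_time /cycle_time => -[E|E|E]; [|exfalso; lra..].
  have ij : i = j.
    have lt_ij : (i < j.+1)%N by rewrite -(ltr_nat R) -natr1; lra.
    have lt_ji : (j < i.+1)%N by rewrite -(ltr_nat R) -natr1; lra.
    by apply/val_inj/eqP; rewrite eqn_leq -ltnS lt_ij -ltnS.
  have st : s = t by rewrite ij in E; exact: addrI E.
  by rewrite ij st.
have pos_int : 0 < position i s < elen (d i).
  have l0 := elen_gt0 (d i); rewrite /position clampE//.
  by case: (b i); apply/andP; split; nra.
have pos_in : in_pieces (inr (d j, position j t)) by exact: position_in.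
move=> /(fmg_proj_interior pos_int pos_in)[/d_inj ij]; subst j.
move=> /(mulIf (lt0r_neq0 (elen_gt0 _))).
rewrite !clampE// /same_time /cycle_time => st; constructor 1.
by move: st; case: (b i); lra.
Qed.

Let cycle_map_eq i j (s t : R) : 0 <= s <= 1 -> 0 <= t <= 1 ->
  cycle_map i s = cycle_map j t <-> same_time i j s t.
Proof.
move=> s01 t01.
have dich u : 0 <= u <= 1 -> 0 < u < 1 \/ (u = 0 \/ u = 1 :> R).
  move=> /andP[u0 u1]; have [->|u_neq0] := eqVneq u 0; first by right; left.
  have [->|u_neq1] := eqVneq u 1; first by right; right.
  by left; rewrite !lt_neqAle u0 u1 u_neq1 eq_sym u_neq0.
have [s_int|/(cycle_map_end i)[k kE0 kE]] := dich _ s01.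
  exact: cycle_map_interior.
have [t_int|/(cycle_map_end j)[l lE0 lE]] := dich _ t01.
  by rewrite same_timeC -cycle_map_interior//; split=> /esym.
rewrite kE0 lE0.
have Ek : k.+1%:R <= n.+1%:R :> R by rewrite ler_nat ltn_ord.
have El : l.+1%:R <= n.+1%:R :> R by rewrite ler_nat ltn_ord.
have k0 : 0 <= k%:R :> R by []. have l0 : 0 <= l%:R :> R by [].
rewrite -natr1 in Ek; rewrite -natr1 in El.
rewrite /same_time; split=> [/fmg_proj_vertex_inj /x_inj kl|st].
  move: kE lE; rewrite kl => -[->|[-> E]] [->|[-> E']].
  - by constructor 1.
  - by constructor 3; lra.
  - by constructor 2; lra.
  - by constructor 1.
suff -> : k = l by [].
apply/val_inj/eqP; rewrite -(eqr_nat R); apply/eqP.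
by case: st => st; case: kE lE => [?|[? ?]] [?|[? ?]]; lra.
Qed.

Lemma cycle_contains_circle : exists A : set T, homeomorphic A (@unit_circle R).
Proof.
(* The circle is run once in total time [n.+1], so [psi] and [cycle_map] identify the same pairs:
   those whose times agree modulo [n.+1]. *)
pose psi (i : 'I_n.+1) (s : R) := circle_point (cycle_time i s / n.+1%:R).
have n0 : 0 < n.+1%:R :> R by rewrite ltr0n.
have time_in (i : 'I_n.+1) s : 0 <= s <= 1 ->
    0 <= cycle_time i s / n.+1%:R <= 1.
  move=> /andP[s0 s1]; rewrite /cycle_time divr_ge0 ?addr_ge0//=.
  have : i.+1%:R <= n.+1%:R :> R by rewrite ler_nat ltn_ord.
  by rewrite ler_pdivrMr// mul1r -natr1; lra.
exists (\bigcup_i (cycle_map i @` `[0, 1])).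
have -> : @unit_circle R = \bigcup_i (psi i @` `[0, 1]).
  rewrite -circle_point_range; apply/seteqP; split=> [z [u]|].
    rewrite /= in_itv/= => /andP[u0 u1] <- {z}.
    (* The integer part of [n.+1%:R * u] is the index of the edge and its fractional part the
       parameter; at [u = 1] that index would be out of range. *)
    have [u_eq1|u_neq1] := eqVneq u 1.
      exists ord_max => //; exists 1; first by rewrite /= in_itv/= ler01 lexx.
      by rewrite u_eq1 /psi /cycle_time natr1 divff// gt_eqF.
    have nu0 : 0 <= n.+1%:R * u by rewrite mulr_ge0.
    have /andP[k1 k2] := truncn_itv nu0.
    have kn : (Num.truncn (n.+1%:R * u) < n.+1)%N.
      by rewrite -(ltr_nat R) (le_lt_trans k1)// gtr_pMr// lt_neqAle u_neq1.
    exists (Ordinal kn) => //.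
    exists (n.+1%:R * u - (Num.truncn (n.+1%:R * u))%:R).
      by rewrite /= in_itv/= subr_ge0 k1/= lerBlDl natr1 ltW.
    by rewrite /psi /cycle_time/= addrC subrK mulrAC divff ?mul1r// gt_eqF.
  move=> z [i _ [s]]; rewrite /= in_itv/= => s01 <- {z}.
  by exists (cycle_time i s / n.+1%:R) => //=; rewrite in_itv/= time_in.
apply: (quotients_homeomorphic (ord0 : 'I_n.+1) 0) => //.
- exact: segment_compact.
- exact: metric_hausdorff.
- move=> i s; apply: continuous_comp; last exact: continuous_circle_point.
  apply: continuousM; last exact: cvg_cst.
  by apply: continuousD; first exact: cvg_cst.
move=> i j s t /=; rewrite !in_itv/= => s01 t01; rewrite cycle_map_eq//.
rewrite circle_point_eq ?time_in// /same_time.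
have E u v : u / n.+1%:R = v / n.+1%:R + 1 :> R <-> u = v + n.+1%:R.
  split=> [E|->]; last by rewrite mulrDl divff// gt_eqF.
  by apply: (mulIf (invr_neq0 (lt0r_neq0 n0))); rewrite mulrDl divff// gt_eqF.
split=> -[H|/E H|/E H]; [|by constructor 2|by constructor 3|
  |by constructor 2|by constructor 3].
  by constructor 1; rewrite H.
by constructor 1; apply: (mulIf (invr_neq0 (lt0r_neq0 n0))).
Qed.

End cycles.

(** * Metric trees *)

Section trees.
Context (R : realType) (T : finite_metric_graph R).
Local Notation G := (fmg_gluing T).
Hypothesis T_tree : is_metric_tree T.
Implicit Types (e : edge G) (u v w : vertex G).

Lemma degreeE v :
  degree v = #|[pred h : edge G * bool | endpoint h.1 h.2 == v]|.
Proof. by apply: eq_card => h; apply/idP/idP; rewrite in_setE. Qed.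

(** Adjacency after removal of [e]; [h] is an oriented edge, leaving from its end [h.2]. *)
Definition adjacent_off e : rel (vertex G) := fun u v =>
  [exists h : edge G * bool,
    [&& h.1 != e, endpoint h.1 h.2 == u & endpoint h.1 (~~ h.2) == v]].

Lemma adjacent_off_edge e e' b : e' != e ->
  adjacent_off e (endpoint e' b) (endpoint e' (~~ b)).
Proof. by move=> ee'; apply/existsP; exists (e', b); rewrite /= ee' !eqxx. Qed.

Lemma connect_off_sym e : connect_sym (adjacent_off e).
Proof.
apply: sym_connect_sym => u v; apply/existsP/existsP => -[[e' b] /=].
  by case/and3P=> ? ? ?; exists (e', ~~ b); rewrite /= negbK; apply/and3P.
by case/and3P=> ? ? ?; exists (e', ~~ b); rewrite /= negbK; apply/and3P.
Qed.

(** A simple path off [e] between the ends of [e] is closed by [e] into a simple cycle, of length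
    one if [e] is a loop. *)
Lemma tree_bridge e b :
  ~~ connect (adjacent_off e) (endpoint e b) (endpoint e (~~ b)).
Proof.
wlog -> : b / b = false.
  by case: b => [|]; last exact; rewrite connect_off_sym => /(_ false); exact.
apply/negP => /= /connectP[p0 /shortenP[p pth uniq_p _] {p0} last_p].
set u := endpoint e false in pth uniq_p last_p.
pose x (i : 'I_(size p).+1) := nth u (u :: p) i.
have x_inj : injective x.
  by move=> i j /eqP; rewrite nth_uniq// => /eqP/val_inj.
(* [h i] is the oriented edge from [x i] to its successor; [e] occurs only as the closing edge, of
   index [size p]. *)
have /choice[h hP] : forall i : 'I_(size p).+1, exists h : edge G * bool,
    [/\ endpoint h.1 h.2 = x i, endpoint h.1 (~~ h.2) = x (ordS i)
      & (h.1 == e) = (i == size p :> nat)].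
  move=> i; have [ip|ip] := eqVneq (i : nat) (size p).
    exists (e, true); split; rewrite /= ?eqxx// /x /= ip.
      by rewrite last_p (last_nth u).
    by rewrite modnn.
  have {}ip : (i < size p)%N by rewrite ltn_neqAle ip -ltnS ltn_ord.
  move/(pathP u) : pth => /(_ _ ip) /existsP[h /and3P[he /eqP h1 /eqP h2]].
  by exists h; split; rewrite ?(negPf he)// /x /= modn_small.
apply: T_tree; apply: (@cycle_contains_circle _ _ (size p) x (fun i => (h i).1)
  (fun i => (h i).2)) => //; [|by move=> i; case: (hP i)..].
(* If the edges of index [i < j] coincided, [j] would not be the closing index and [x i] would be an
   end of the later edge, that is [x j] or [x j.+1], against injectivity. *)
suff lt_neq (i j : 'I_(size p).+1) : (i < j)%N -> (h i).1 <> (h j).1.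
  move=> i j hij; apply/val_inj/eqP; have [ij|ij|//] := ltngtP i j.
    by case: (lt_neq _ _ ij).
  by case: (lt_neq _ _ ij).
have [ti _ ei] := hP i; have [tj hj ej] := hP j => ij hij.
have jp : (j < size p)%N.
  rewrite ltn_neqAle -ltnS ltn_ord andbT -ej -hij ei neq_ltn.
  by rewrite (leq_trans ij)// -ltnS.
have : x i = x j \/ x i = x (ordS j).
  by rewrite -ti -tj -hj hij; case: (h i).2; case: (h j).2; tauto.
move=> [] /x_inj E; move: ij; rewrite E ?ltnn//=.
by rewrite modn_small// ltnNge leqnSn.
Qed.

(** Induction on the size of the component beyond [e]: if its first vertex is not a leaf, another
    edge [e'] leaves it, and the component beyond [e'] is strictly smaller as it omits that
    vertex. *)
Lemma tree_leaf_beyond e b :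
  exists2 v, connect (adjacent_off e) (endpoint e b) v & degree v = 1%N.
Proof.
have [k] := ubnP #|connect (adjacent_off e) (endpoint e b)|.
elim: k => // k IH in e b *; rewrite ltnS => card_k.
have [deg1|deg1] := eqVneq (degree (endpoint e b)) 1%N.
  by exists (endpoint e b).
(* The end [(e, b)] already counts in the degree, so there is a second one; it is not the other end
   of [e], since a bridge is not a loop. *)
have [e' [b' [e'e e'b]]] : exists e' b',
    e' != e /\ endpoint e' b' = endpoint e b.
  move: deg1; rewrite degreeE (cardD1 (e, b)) inE eqxx eqSS => /pred0Pn[[e' b']].
  rewrite !inE/= => /andP[neq /eqP e'b].
  exists e', b'; split=> //; apply: contra neq => /eqP ee'; subst e'.
  have [->//|bb'] := eqVneq b' b; have := tree_bridge e b.
  by rewrite -(_ : b' = ~~ b) ?e'b ?connect0//; case: (b') (b) bb' => -[].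
have off_v : ~~ connect (adjacent_off e') (endpoint e' (~~ b')) (endpoint e b).
  by have := tree_bridge e' (~~ b'); rewrite negbK e'b.
(* A path beyond [e'] cannot use [e], as it would then visit [endpoint e b]. *)
have off_sub w : connect (adjacent_off e') (endpoint e' (~~ b')) w ->
    connect (adjacent_off e) (endpoint e b) w.
  move=> /connectP[p pth ->]; elim/last_ind: p pth => [_|p w' IHp].
    by rewrite /= -e'b connect1 ?adjacent_off_edge.
  rewrite rcons_path last_rcons => /andP[pth adj].
  have conn : connect (adjacent_off e') (endpoint e' (~~ b'))
    (last (endpoint e' (~~ b')) p) by apply/connectP; exists p.
  have conn' := connect_trans conn (connect1 adj).
  apply: connect_trans (IHp pth) (connect1 _).
  move: adj => /existsP[[g c] /and3P[/= _ /eqP gc /eqP gc']].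
  have [ge|ge] := eqVneq g e; last first.
    by apply/existsP; exists (g, c); rewrite /= ge gc gc' !eqxx.
  subst g; case/negP: off_v.
  by have [<-|/negPf cb] := eqVneq c b; rewrite ?gc// -(_ : ~~ c = b) ?gc'//;
    case: (c) (b) cb => -[].
have [|v ev dv] := IH e' (~~ b').
  apply: leq_trans card_k; apply/proper_card/properP; split.
    by apply/fintype.subsetP => w; exact: off_sub.
  by exists (endpoint e b); rewrite ?inE ?connect0//; exact: off_v.
by exists v => //; exact: off_sub.
Qed.

(** As [e] is a bridge, a chain that changes side must cross [t] by a move inside [e]; splitting
    that move at [t] bounds its length from below. *)
Lemma tree_cut e t : 0 < t < elen e -> exists side : prepoint G -> bool,
  (forall p q, in_pieces p -> in_pieces q -> side p != side q ->
     mdist (fmg_proj p : T) (fmg_proj (inr (e, t))) +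
     mdist (fmg_proj (inr (e, t)) : T) (fmg_proj q) <=
     mdist (fmg_proj p : T) (fmg_proj q)) /\
  (forall b, exists2 v, degree v = 1%N & side (inl v) = b).
Proof.
move=> t_int; have [t0 t1] := andP t_int.
have t_in : 0 <= t <= elen e by rewrite !ltW.
pose S := connect (adjacent_off e) (endpoint e false).
(* True on the side of [endpoint e false]; the cut point itself is counted on the other side. *)
pose side (p : prepoint G) := match p with
  | inl v => S v
  | inr (e', s) => if e' == e then s < t else S (endpoint e' false) end.
have S_end e' b : e' != e -> S (endpoint e' b) = S (endpoint e' false).
  case: b => // e'e; apply/esym/(same_connect_r (@connect_off_sym e))/connect1.
  exact: (adjacent_off_edge false).
have side_jump e' b : side (segment_end e' b) = side (inl (endpoint e' b)).
  rewrite /side /=; case: eqP => [->|/eqP e'e]; last by rewrite S_end.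
  case: b; rewrite /S ?connect0//.
  by rewrite (negPf (tree_bridge e false)) ltNge ltW.
have crossing p q c : chain p q c -> side p != side q -> exists c1 c2,
    [/\ chain p (inr (e, t)) c1, chain (inr (e, t)) q c2 & c1 + c2 <= c].
  elim=> {p q c} [p|e' s s' q c s_in s'_in ch IH|e' b q c _ IH|e' b q c _ IH].
  - by rewrite eqxx.
  - have [same|cross _] := eqVneq (side (inr (e', s))) (side (inr (e', s'))).
      move=> pq; rewrite same in pq; have [c1 [c2 [ch1 ch2 c12]]] := IH pq.
      exists (`|s - s'| + c1), c2; split=> //; first exact: chain_move ch1.
      by rewrite -addrA lerD2l.
    move: cross s_in s'_in ch; rewrite /side/=.
    have [->|_] := eqVneq e' e => cross s_in s'_in ch;
      last by rewrite eqxx in cross.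
    exists (`|s - t| + 0), (`|t - s'| + c); split.
    + exact: chain_move (chain_refl _).
    + exact: chain_move ch.
    rewrite addr0 addrA lerD2r; move: cross.
    have [st|st] := ltP s t; have [s't|s't] := ltP s' t => // _.
      by rewrite !ler0_norm; lra.
    by rewrite !ger0_norm; lra.
  - rewrite side_jump => /IH[c1 [c2 [ch1 ch2 c12]]].
    by exists c1, c2; split=> //; exact: chain_to_vertex.
  - rewrite -side_jump => /IH[c1 [c2 [ch1 ch2 c12]]].
    by exists c1, c2; split=> //; exact: chain_from_vertex.
exists side; split=> [p q ip iq pq|[]].
- rewrite -lee_fin (fmg_proj_dist ip iq); apply: le_ereal_inf_tmp => _ [c ch <-].
  have [c1 [c2 [ch1 ch2 c12]]] := crossing _ _ _ ch pq.
  by rewrite lee_fin (le_trans _ c12)// lerD// mdist_fmg_proj_le.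
- by have [v ev dv] := tree_leaf_beyond e false; exists v.
- have [v ev dv] := tree_leaf_beyond e true; exists v => //=.
  apply/negP => Sv; have /negP := tree_bridge e false; apply.
  by apply: connect_trans Sv _; rewrite connect_off_sym.
Qed.

End trees.

(** * Hausdorff distances *)

Section hausdorff_distances.
Context (R : realType).

Lemma lte_dense_fin (a b : \bar R) : (a < b)%E ->
  exists r : R, (a < r%:E)%E /\ (r%:E < b)%E.
Proof.
case: a b => [a| |] [b| |] //=.
- by rewrite lte_fin => ab; exists ((a + b) / 2); rewrite !lte_fin !midf_lt.
- by move=> _; exists (a + 1); rewrite lte_fin ltrDl ltry; split.
- by move=> _; exists (b - 1); rewrite lte_fin gtrBl ltNyr; split.
- by move=> _; exists 0; rewrite ltNyr ltry; split.
Qed.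

Lemma dir_hausdorff_lt (Z : metricType R) (A B : set Z) (r : R) a :
  (dir_hausdorff A B < r%:E)%E -> A a -> exists2 b, B b & mdist a b < r.
Proof.
move=> ABr Aa; have /ereal_inf_lt[_ [b Bb <-]] :
    (ereal_inf [set (mdist a b)%:E | b in B] < r%:E)%E.
  by apply: le_lt_trans ABr; apply: ereal_sup_ubound; exists a.
by rewrite lte_fin; exists b.
Qed.

(** The margin between [r] and [r'] is uniform in [b], which leaves room to move [a] afterwards. *)
Lemma lt_dir_hausdorff (Z : metricType R) (A B : set Z) (r : R) :
  (r%:E < dir_hausdorff A B)%E ->
  exists2 a, A a & exists2 r', r < r' & forall b, B b -> r' < mdist a b.
Proof.
move=> /ereal_sup_gt[_ [a Aa <-]] /lte_dense_fin[r' [rr' r'inf]].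
exists a => //; exists r' => // b Bb; rewrite -lte_fin (lt_le_trans r'inf)//.
by apply: ereal_inf_lbound; exists b.
Qed.

Lemma gromov_hausdorff_le_hausdorff (T : metricType R) (X : set T) :
  (gromov_hausdorff T (restricted X) <= hausdorff_dist [set: T] X)%E.
Proof.
apply: ereal_inf_lbound; exists T, idfun, (fun x => \val x); split=> //.
rewrite image_id; congr hausdorff_dist; apply/seteqP; split=> x.
- by move=> Xx; exists (SigSub (mem_set Xx)).
- by move=> [y _ <-]; exact: set_valP.
Qed.

(* The neighbourhoods of [g @` X_ true] and [g @` X_ false] of radius [r] are
   disjoint and cover the connected set [range f]. *)
Lemma no_separated_correspondence (T Z : metricType R) (X : set T) (f : T -> Z)
    (g : restricted X -> Z) (X_ : bool -> set (restricted X)) (r : R) :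
  connected [set: T] -> isometric_embedding f -> isometric_embedding g ->
  (dir_hausdorff (range f) (range g) < r%:E)%E ->
  (dir_hausdorff (range g) (range f) < r%:E)%E ->
  (forall x, X_ true x \/ X_ false x) -> (forall b, X_ b !=set0) ->
  (forall x y, X_ true x -> X_ false y -> r + r < mdist x y) -> False.
Proof.
move=> cT isof isog fg gf cover X_neq0 X_sep.
pose A b : set T := [set t | exists2 x, X_ b x & mdist (f t) (g x) < r].
have A_open b : open (A b).
  rewrite openE => t [x Xx tx]; apply/nbhs_ballP.
  exists (r - mdist (f t) (g x)); rewrite /= ?subr_gt0// => s.
  rewrite ballEmdist /= ltrBrDr => ts; exists x => //; apply: le_lt_trans ts.
  by rewrite -(isof t) [mdist (f t) (f s)]metric_sym metric_triangle.
have A_neq0 b : A b !=set0.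
  have [x Xx] := X_neq0 b.
  have [_ [t _ <-] xt] := dir_hausdorff_lt gf (imageT g x).
  by exists t, x; rewrite // metric_sym.
have A_compl : A true = ~` A false.
  apply/seteqP; split=> [t [x Xx tx] [y Xy ty]|t nAt].
    have := X_sep _ _ Xx Xy; rewrite -isog; apply/negP; rewrite -leNgt.
    rewrite (le_trans (metric_triangle _ (f t) _))// metric_sym.
    by rewrite lerD// ltW.
  have [_ [x _ <-] tx] := dir_hausdorff_lt fg (imageT f t).
  by have [Xx|Xx] := cover x; [exists x|case: nAt; exists x].
have A_setT : A true = setT.
  apply: cT => //; first by exists (A true); rewrite // setTI.
  by exists (A true); rewrite ?setTI// A_compl closedC.
have [t At] := A_neq0 false.
have : A true t by rewrite A_setT.
by rewrite A_compl.
Qed.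

End hausdorff_distances.

(** * Cutting the tree at a point far from the subset *)

(** Every point of an edge can be pushed slightly inwards. The only other points are isolated
    vertices: no chain leaves them, so finiteness of the distances leaves a single point. *)
Lemma fmg_near_interior (R : realType) (T : finite_metric_graph R) (x : T) (r : R) :
  0 < r ->
  (exists e t, 0 < t < elen e /\ mdist x (fmg_proj (inr (e, t))) < r) \/
  (forall y : T, y = x).
Proof.
move=> r0.
have near_segment e s : 0 <= s <= elen e ->
    exists e' t, 0 < t < elen e' /\
      mdist (fmg_proj (inr (e, s)) : T) (fmg_proj (inr (e', t))) < r.
  move=> s_in; have [s0 s1] := andP s_in.
  suff [t [t_int str]] : exists t, 0 < t < elen e /\ `|s - t| < r.
    exists e, t; split => //; apply: le_lt_trans str.
    by case/andP: t_int => t0 t1; apply: mdist_fmg_proj_segment; rewrite // !ltW.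
  have l0 := elen_gt0 e.
  pose m := Num.min r (elen e); have m0 : 0 < m by rewrite lt_min r0.
  (* A shift by [m / 3] towards the farther end is shorter than [r] and stays inside the edge. *)
  have [mr ml] : m <= r /\ m <= elen e by rewrite !ge_min !lexx orbT.
  have [sl|sl] := leP s (elen e / 2).
    exists (s + m / 3); split; first by apply/andP; split; lra.
    by rewrite ltr0_norm; lra.
  exists (s - m / 3); split; first by apply/andP; split; lra.
  by rewrite gtr0_norm; lra.
have [[v|[e s]] px <-] := fmg_proj_surj x; last by left; exact: near_segment.
have [[e [b <-]]|isolated] := pselect (exists e b, endpoint e b = v).
  left; rewrite -fmg_proj_end.
  by apply: near_segment; exact: (segment_end_in e b).
right=> y; have [q iq <-] := fmg_proj_surj y.
have /eqP := fmg_proj_dist px iq; rewrite eq_le => /andP[_].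
rewrite /glued_dist => /le_lt_trans/(_ (ltry _))/ereal_inf_lt[_ [c ch _] _].
suff : forall p q c, chain p q c -> p = inl v -> q = inl v.
  by move=> /(_ _ _ _ ch) ->.
move=> p' q' c'; elim=> // e b p0 c0 _ _ [ev].
by case: isolated; exists e, b.
Qed.

Local Open Scope ereal_scope.

Theorem theorem2 (R : realType) (T : finite_metric_graph R)
    (T_tree : is_metric_tree T) (X : set T) :
  dir_hausdorff (leaves T) X < hausdorff_dist [set: T] X ->
  gromov_hausdorff T (restricted X) = hausdorff_dist [set: T] X.
Proof.
move=> leaves_lt; apply/eqP; rewrite eq_le gromov_hausdorff_le_hausdorff /=.
apply: le_ereal_inf_tmp => _ [Z [f [g [isof isog ->]]]].
rewrite leNgt; apply/negP => fg_lt.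
have [r []] : exists r : R,
    maxe (hausdorff_dist (range f) (range g)) (dir_hausdorff (leaves T) X) < r%:E
    /\ r%:E < hausdorff_dist [set: T] X.
  by apply: lte_dense_fin; rewrite gt_max fg_lt leaves_lt.
rewrite !gt_max lt_max => /andP[/andP[fg gf] leaves_r] r_lt.
have r_gt0 (p : T) : (0 < r)%R.
  have [z _ pz] := dir_hausdorff_lt fg (imageT f p).
  exact: le_lt_trans (mdist_ge0 _ _) pz.
(* Points of [X] are at distance 0 from [T], so the maximum can exceed [r] only in the direction
   from [T] to [X]. *)
have /lt_dir_hausdorff[p0 _ [r' rr' p0X]] : r%:E < dir_hausdorff [set: T] X.
  case/orP: r_lt => // /lt_dir_hausdorff[p _ [r' rr' /(_ p I)]].
  by rewrite mdistxx ltNge (ltW (lt_trans (r_gt0 p) rr')).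
have [|[e [t [t_int p0t]]]|single] := @fmg_near_interior _ _ p0 (r' - r).
- by rewrite subr_gt0.
- set p : T := fmg_proj (inr (e, t)) in p0t.
  have pX x : X x -> (r < mdist p x)%R.
    move=> /p0X p0x; rewrite -(ltrD2l (mdist p0 p)).
    rewrite (lt_le_trans _ (metric_triangle p0 p x))// (lt_trans _ p0x)//.
    by rewrite -ltrBrDr.
  have [side [cut leaf]] := tree_cut T_tree t_int.
  pose X_ b : set (restricted X) := [set x | exists q,
    [/\ in_pieces q, fmg_proj q = \val x & side q = b]].
  apply: (@no_separated_correspondence _ _ _ X f g X_ r) => //.
  + exact: fmg_connected.
  + move=> x; have [q iq qx] := fmg_proj_surj (\val x : T).
    by case: (boolP (side q)) => [sq|/negbTE sq]; [left|right]; exists q.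
  + move=> b; have [v deg_v side_v] := leaf b.
    have leaf_v : leaves T (fmg_proj (inl v)) by exists v.
    have [x Xx vx] := dir_hausdorff_lt leaves_r leaf_v.
    have [q iq qx] := fmg_proj_surj x.
    exists (SigSub (mem_set Xx) : set_type X), q; split=> //.
    (* Were [x] on the other side from the leaf, the way from the leaf to [x] would pass through
       [p], already more than [r] away from [x]. *)
    rewrite -side_v; apply/eqP/negPn/negP => vq.
    have := cut (inl v) q I iq; rewrite eq_sym => /(_ vq).
    rewrite qx leNgt (lt_le_trans vx)// (le_trans (ltW (pX _ Xx)))//.
    by rewrite lerDr mdist_ge0.
  + move=> x y [q [iq qx sq]] [q' [iq' qy sq']].
    have := cut q q' iq iq'; rewrite sq sq' => /(_ isT).
    rewrite mdist_restricted -qx -qy; apply: lt_le_trans; rewrite ltrD//.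
      by rewrite metric_sym qx; apply: pX; exact: set_valP.
    by rewrite qy; apply: pX; exact: set_valP.
(* When [T] is a single point, [X] is nonempty and so contains [p0], which cannot be far from
   [X]. *)
- have [_ [x _ _] _] := dir_hausdorff_lt fg (imageT f p0).
  have := p0X _ (set_valP x); rewrite (single (\val x)) mdistxx ltNge.
  by rewrite (ltW (lt_trans (r_gt0 p0) rr')).
Qed.
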